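(* Let $V$ be a smooth scheme over a field, let $\mathcal{G}=\bigoplus_n I_nW^n$ be a Rees algebra over $V$, let $x\in\mathrm{Sing}(\mathcal{G})$, and suppose that locally at $x$, $\mathcal{G}=\mathcal{O}_{V,x}[f_1W^{n_1},\dots,f_sW^{n_s}]$ with all $n_i\ge1$. Let $N>0$ be an integer which is a common multiple of all $n_i$, $i=1,\dots,s$, and let $\mathcal{G}_N=\mathcal{O}_V[I_NW^N]$ be the Rees ring attached to $I_N$. Then $\tau_{\mathcal{G},x}=\tau_{\mathcal{G}_N,x}$.
   Context: A Rees algebra over a smooth scheme $V$ is a graded subalgebra $\mathcal{G}=\bigoplus_{n\ge 0} I_nW^n$ of $\mathcal{O}_V[W]$ ($W$ a dummy variable), where the $I_n$ are sheaves of ideals with $I_0=\mathcal{O}_V$ and $I_sI_t\subset I_{s+t}$, which is locally a finitely generated $\mathcal{O}_V$-algebra. The singular locus is $\mathrm{Sing}(\mathcal{G})=\{x\in V : \nu_x(I_n)\ge n \text{ for all } n\ge 1\}$, with $\nu_x(I_n)$ the order of $I_n$ at $\mathcal{O}_{V,x}$. $\mathcal{G}_N=\mathcal{O}_V[I_NW^N]$ is the subalgebra of $\mathcal{O}_V[W]$ generated by $I_NW^N$, whose component of degree $mN$ is $I_N^m W^{mN}$ and whose components in degrees not divisible by $N$ are zero. For a Rees algebra $\mathcal{H}=\bigoplus J_nW^n$ and $x\in\mathrm{Sing}(\mathcal{H})$, with maximal ideal $\mathfrak{M}_x\subset\mathcal{O}_{V,x}$ and residue field $k(x)$, $\mathbb{I}_{\mathcal{H},x}$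 is the homogeneous ideal of $gr_{\mathfrak{M}_x}(\mathcal{O}_{V,x})$ generated by the images of $J_n$ in $\mathfrak{M}_x^n/\mathfrak{M}_x^{n+1}$ for all $n\ge1$. The cone $\mathcal{C}_{\mathcal{H}}\subset\mathbb{T}_{V,x}=\mathrm{Spec}(gr_{\mathfrak{M}_x}(\mathcal{O}_{V,x}))$ is the zero set of $\mathbb{I}_{\mathcal{H},x}$ (as a closed subset, equivalently reduced closed subscheme). The linear space of vertices $\mathcal{L}_{\mathcal{H},x}$ is the largest $k(x)$-linear subspace such that translation by each of its vectors maps $\mathcal{C}_{\mathcal{H}}$ onto itself. Hironaka's $\tau$-invariant $\tau_{\mathcal{H},x}$ is the codimension of $\mathcal{L}_{\mathcal{H},x}$ in $\mathbb{T}_{V,x}$. *)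

(* Defs.v *)
From HB Require Import structures.
From mathcomp Require Import all_boot all_order all_algebra.
From mathcomp Require Import ring_quotient generic_quotient.
From mathcomp Require Import mpoly.
From mathcomp Require Import boolp classical_sets topology_structure.

Set Implicit Arguments.
Unset Strict Implicit.
Unset Printing Implicit Defensive.
Import GRing.Theory.

Local Open Scope classical_set_scope.
Local Open Scope ring_scope.
Local Open Scope quotient_scope.

Section Ideals.
Variable A : comPzRingType.
Implicit Types (I J S : set A).

Definition is_ideal I :=
  [/\ I 0, (forall a b, I a -> I b -> I (a + b)) & (forall a b, I b -> I (a * b))].

Definition is_prime_ideal I :=
  [/\ is_ideal I, ~ I 1 & forall a b, I (a * b) -> I a \/ I b].

Definition ideal_span S : set A :=
  [set a | forall I, is_ideal I -> S `<=` I -> I a].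

Fixpoint ideal_pow I n : set A :=
  if n is m.+1 then
    ideal_span [set c | exists a b, [/\ I a, ideal_pow I m b & c = a * b]]
  else setT.

Definition invertible (a : A) := exists b, a * b = 1.

Lemma ideal_span_ideal S : is_ideal (ideal_span S).
Proof.
split=> [I [] //|a b Ia Ib I HI SI|a b Ib I HI SI].
  by case: (HI) => _ HD _; apply: HD; [apply: Ia|apply: Ib].
by case: (HI) => _ _; apply; apply: Ib.
Qed.

Lemma sub_ideal_span S : S `<=` ideal_span S.
Proof. by move=> a Sa I _; apply. Qed.

Lemma ideal_pow_ideal I n : is_ideal (ideal_pow I n).
Proof. by case: n => [|n] /=; [split|apply: ideal_span_ideal]. Qed.

Lemma ideal_powD I m n a b :
  ideal_pow I m a -> ideal_pow I n b -> ideal_pow I (m + n) (a * b).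
Proof.
elim: m a => [|m IH] a Ia Ib.
  by rewrite add0n; case: (ideal_pow_ideal I n) => _ _; apply.
have [J0 JD JM] := ideal_pow_ideal I (m.+1 + n).
apply: (Ia [set a | ideal_pow I (m.+1 + n) (a * b)]).
  split=> [|x y /= Hx Hy|x y /= Hy].
  - by rewrite /= mul0r.
  - by rewrite mulrDl; apply: JD.
  - by rewrite -mulrA; apply: JM.
move=> _ [x [y [Ix Iy ->]]] /=; rewrite -mulrA.
apply: sub_ideal_span; exists x, (y * b); split=> //; exact: IH.
Qed.

Lemma ideal_pow1 I : is_ideal I -> ideal_pow I 1 = I.
Proof.
move=> HI; apply/seteqP; split=> [a|a Ia].
  apply=> // _ [x [y [Ix _ ->]]]; rewrite mulrC.
  by case: HI => _ _; apply.
by apply: sub_ideal_span; exists a, 1; split; rewrite ?mulr1.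
Qed.

End Ideals.

(** * Local rings: residue field and associated graded ring *)

Record localRing := LocalRing {
  local_ring :> comNzRingType;
  local_ringP : forall a b : local_ring,
    ~ invertible a -> ~ invertible b -> ~ invertible (a + b)
}.

Section LocalRingTheory.
Variable R : localRing.

Definition maxid : set R := [set a | ~ invertible a].

Lemma maxid_ideal : is_ideal maxid.
Proof.
split=> [[b]|a b|a b nb [c]]; first by rewrite mul0r => /esym/eqP; rewrite oner_eq0.
  exact: local_ringP.
by move=> E; apply: nb; exists (a * c); rewrite mulrCA mulrA.
Qed.

Lemma maxid1 : ~ maxid 1.
Proof. by apply; exists 1; rewrite mulr1. Qed.

Definition in_maxid : {pred R} := fun a => `[< maxid a >].

Lemma in_maxidP : idealr_closed in_maxid.
Proof.
have [M0 MD MM] := maxid_ideal.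
split; first exact/asboolP.
  by apply/asboolP; apply: maxid1.
move=> a b c /asboolP Mb /asboolP Mc; apply/asboolP.
by apply: MD => //; apply: MM.
Qed.

HB.instance Definition _ := isIdealr.Build R in_maxid in_maxidP.

Definition residue := {ideal_quot in_maxid}.

HB.instance Definition _ := GRing.ComNzRing.on residue.

Lemma residue_field (c : residue) : c != 0 -> invertible c.
Proof.
rewrite -[c]reprK => c0.
have : invertible (repr c).
  apply: contrapT => nc; move/eqP: c0; apply.
  have -> : 0 = \pi_residue 0 by rewrite piE.
  by apply/eqP; rewrite piE Quotient.equivE subr0; apply/asboolP.
case=> b /(congr1 \pi_residue); rewrite rmorphM rmorph1 => E.
by exists (\pi_residue b).
Qed.

(* gr_M(R) is the sum of the M^n/M^(n+1); it is realised as the quotient of the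
   subring [mrees] of polynomials p with p_n in M^n by the ideal of those
   with p_n in M^(n+1). *)
Definition in_mrees : {pred {poly R}} :=
  fun p => `[< forall n, ideal_pow maxid n p`_n >].

Lemma in_mreesP : subring_closed in_mrees.
Proof.
split=> [|p q /asboolP Hp /asboolP Hq|p q /asboolP Hp /asboolP Hq];
    apply/asboolP=> n; have [J0 JD JM] := ideal_pow_ideal maxid n.
- by rewrite coef1; case: n J0 {JD JM} => //= n.
- by rewrite coefB -mulN1r; apply: JD => //; apply: JM.
rewrite coefM; apply: (big_ind (ideal_pow maxid n) J0 JD) => i _.
have le_in : (i <= n)%N by rewrite -ltnS.
by rewrite -[X in ideal_pow _ X](subnKC le_in); apply: ideal_powD.
Qed.

HB.instance Definition _ := GRing.isSubringClosed.Build _ in_mrees in_mreesP.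

Record mrees := Mrees { mrees_val :> {poly R}; _ : mrees_val \in in_mrees }.

HB.instance Definition _ := [isSub for mrees_val].
HB.instance Definition _ := [Choice of mrees by <:].
HB.instance Definition _ := [SubChoice_isSubComNzRing of mrees by <:].

Definition in_mrees_irr : {pred mrees} :=
  fun p => `[< forall n, ideal_pow maxid n.+1 (val p)`_n >].

Lemma in_mrees_irrP : idealr_closed in_mrees_irr.
Proof.
split; first by apply/asboolP=> n; rewrite coef0; case: (ideal_pow_ideal maxid n.+1).
  apply/negP=> /asboolP /(_ 0); rewrite ideal_pow1; last exact: maxid_ideal.
  by rewrite coef1; apply: maxid1.
move=> p q r /asboolP Hq /asboolP Hr; apply/asboolP=> n.
have [J0 JD JM] := ideal_pow_ideal maxid n.+1.
rewrite coefD; apply: (JD) => //; rewrite coefM.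
apply: (big_ind (ideal_pow maxid n.+1) J0 JD) => i _.
have Hp m : ideal_pow maxid m (val p)`_m by move: m; apply/asboolP; exact: (valP p).
have le_in : (i <= n)%N by rewrite -ltnS.
by have := ideal_powD (Hp i) (Hq (n - i)%N); rewrite addnS subnKC.
Qed.

HB.instance Definition _ := isIdealr.Build mrees in_mrees_irr in_mrees_irrP.

Definition gr := {ideal_quot in_mrees_irr}.

HB.instance Definition _ := GRing.ComNzRing.on gr.

(* The class of a in M^n/M^(n+1), the degree n component of gr;
   only meaningful for a in M^n. *)
Definition gr_class (n : nat) (a : R) : gr :=
  \pi_gr (insubd (0 : mrees) (a%:P * 'X^n)).

Definition gr_deg (n : nat) : set gr :=
  [set xi | exists2 a, ideal_pow maxid n a & xi = gr_class n a].

(* The identification of the residue field R/M with the degree 0 component. *)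
Definition gr_const (c : residue) : gr := gr_class 0 (repr c).

Lemma mrees_deg0 (c : R) : val (insubd (0 : mrees) (c%:P * 'X^0)) = c%:P.
Proof.
rewrite val_insubd mulr1 ifT //; apply/asboolP=> -[|n] //.
by rewrite coefC; case: (ideal_pow_ideal maxid n.+1).
Qed.

Lemma gr_class0_zmod : zmod_morphism (gr_class 0).
Proof.
move=> a b; rewrite /gr_class -rmorphB; congr (\pi_gr _); apply: val_inj.
rewrite [LHS]mrees_deg0 polyCB [RHS]raddfB.
by congr (_ - _); apply/esym/mrees_deg0.
Qed.

Lemma gr_class0_monoid : monoid_morphism (gr_class 0).
Proof.
split=> [|a b]; rewrite /gr_class -?(rmorphM \pi_gr) -?(rmorph1 \pi_gr);
  congr (\pi_gr _); apply: val_inj.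
  exact: mrees_deg0.
rewrite [LHS]mrees_deg0 polyCM [RHS]rmorphM.
by congr (_ * _); apply/esym/mrees_deg0.
Qed.

HB.instance Definition _ :=
  GRing.isZmodMorphism.Build R gr (gr_class 0) gr_class0_zmod.
HB.instance Definition _ :=
  GRing.isMonoidMorphism.Build R gr (gr_class 0) gr_class0_monoid.

Lemma gr_constE a : gr_const (\pi a) = gr_class 0 a.
Proof.
apply/eqP; rewrite -subr_eq0 /gr_const -rmorphB /=; apply/eqP.
have -> : 0 = \pi_gr 0 by rewrite piE.
apply/eqP; rewrite /gr_class piE Quotient.equivE subr0.
apply/asboolP=> n; rewrite mrees_deg0 coefC.
case: n => [|n]; last by case: (ideal_pow_ideal maxid n.+2).
rewrite ideal_pow1; last exact: maxid_ideal.
have E : repr (\pi_residue a) = a %[mod residue] by rewrite reprK.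
by move/eqP: E; rewrite -Quotient.idealrBE => /asboolP.
Qed.

Lemma gr_const_zmod : zmod_morphism gr_const.
Proof.
move=> c d; rewrite -[c]reprK -[d]reprK -rmorphB !gr_constE; exact: rmorphB.
Qed.

Lemma gr_const_monoid : monoid_morphism gr_const.
Proof.
split=> [|c d]; first by rewrite -(rmorph1 \pi_residue) gr_constE rmorph1.
by rewrite -[c]reprK -[d]reprK -rmorphM !gr_constE; exact: rmorphM.
Qed.

HB.instance Definition _ :=
  GRing.isZmodMorphism.Build residue gr gr_const gr_const_zmod.
HB.instance Definition _ :=
  GRing.isMonoidMorphism.Build residue gr gr_const gr_const_monoid.

(** ** The tangent space T = Spec gr, and the codimension of vertices *)

Implicit Types (v w : gr -> residue) (C : set (set gr)).

(* The vectors of T are the linear forms over the residue field on the degree 1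
   component M/M^2; such a form is encoded by its extension by 0 to the
   components of other degrees. *)
Definition is_vector v :=
  (forall c xi eta, v (gr_const c * xi + eta) = c * v xi + v eta) /\
  (forall n xi, n != 1%N -> gr_deg n xi -> v xi = 0).

(* The comorphism of the translation by v. *)
Definition is_translation v (phi : {rmorphism gr -> gr}) :=
  (forall c, phi (gr_const c) = gr_const c) /\
  (forall xi, gr_deg 1 xi -> phi xi = xi + gr_const (v xi)).

(* Subsets of T are sets of prime ideals of gr; the translation maps the prime
   P to its inverse image under the comorphism. *)
Definition translates_onto v C :=
  exists2 phi : {rmorphism gr -> gr},
    is_translation v phi & [set phi @^-1` P | P in C] = C.

Definition is_linear_subspace (L : set (gr -> residue)) :=
  [/\ L `<=` is_vector, L (fun=> 0) &
      forall c v w, L v -> L w -> L (fun xi => c * v xi + w xi)].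

Definition stabilizing_subspace C (L : set (gr -> residue)) :=
  is_linear_subspace L /\ (forall v, L v -> translates_onto v C).

(* The sum of two stabilizing subspaces is again stabilizing, as the composite
   of translations is the translation by the sum: the union of all stabilizing
   subspaces is the largest one (see [vertices_stabilizing]). *)
Definition vertices C : set (gr -> residue) :=
  [set v | exists2 L, stabilizing_subspace C L & L v].

Lemma is_vector_lin c v w :
  is_vector v -> is_vector w -> is_vector (fun xi => c * v xi + w xi).
Proof.
move=> [vL v0] [wL w0]; split=> [d xi eta|n xi n1 xin].
  by rewrite vL wL !mulrDr !mulrA [c * d]mulrC addrACA.
by rewrite (v0 n) // (w0 n) // mulr0 addr0.
Qed.

Lemma translates_onto0 C : translates_onto (fun=> 0) C.
Proof.
exists idfun; first by split=> // xi _; rewrite rmorph0 addr0.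
apply/seteqP; split=> [_ [P CP <-]|P CP]; first by rewrite preimage_id.
by exists P; rewrite ?preimage_id.
Qed.

Lemma translates_ontoD C v w : translates_onto v C -> translates_onto w C ->
  translates_onto (fun xi => v xi + w xi) C.
Proof.
move=> [phi [phi0 phi1] phiC] [psi [psi0 psi1] psiC]; exists (phi \o psi).
  split=> [c|xi Hxi] /=; first by rewrite psi0 phi0.
  by rewrite psi1 // rmorphD phi1 // phi0 rmorphD addrA.
apply/seteqP; split=> [_ [P CP <-]|P].
  rewrite comp_preimage -psiC; exists (phi @^-1` P) => //.
  by rewrite -phiC; exists P.
rewrite -{1}psiC => -[Q]; rewrite -{1}phiC => -[Q' CQ' <-] <-.
by exists Q'.
Qed.

Lemma vertices_stabilizing C : stabilizing_subspace C (vertices C).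
Proof.
split; last by move=> v [L [_ LC] Lv]; exact: LC.
split=> [v [L [[LT _ _] _] Lv]||c v w [L1 [[T1 Z1 D1] C1] v1] [L2 [[T2 Z2 D2] C2] w2]].
- exact: LT.
- exists [set fun=> 0] => //; split; last by move=> _ ->; exact: translates_onto0.
  split=> // [_ ->|c _ _ -> ->].
    by split=> [c xi eta|]; rewrite ?mulr0 ?addr0.
  by apply/funext=> xi; rewrite mulr0 addr0.
- exists [set u | exists v' w', [/\ L1 v', L2 w' & u = fun xi => v' xi + w' xi]].
    split; last by move=> _ [v' [w' [Lv Lw ->]]]; apply: translates_ontoD; auto.
    split=> [_ [v' [w' [Lv Lw ->]]]||d _ _ [v' [w' [Lv Lw ->]]] [v'' [w'' [Lv' Lw' ->]]]].
    + have := is_vector_lin 1 (T1 _ Lv) (T2 _ Lw).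
      by under eq_fun do rewrite mul1r.
    + exists (fun=> 0), (fun=> 0); split=> //.
      by apply/funext=> xi; rewrite addr0.
    + exists (fun xi => d * v' xi + v'' xi), (fun xi => d * w' xi + w'' xi).
      split; [exact: D1|exact: D2|apply/funext=> xi].
      by rewrite mulrDr addrACA.
  exists (fun xi => c * v xi + 0), w; split=> //; first exact: D1.
  by apply/funext=> xi; rewrite addr0.
Qed.

(* d vectors whose classes form a basis of the quotient of T by L. *)
Definition has_codim (L : set (gr -> residue)) (d : nat) :=
  exists e : 'I_d -> gr -> residue,
    (forall i, is_vector (e i)) /\
    (forall v, is_vector v ->
       exists! c : {ffun 'I_d -> residue},
         L (fun xi => v xi - \sum_(i < d) c i * e i xi)).

Definition codim (L : set (gr -> residue)) : nat := xget 0%N (has_codim L).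

End LocalRingTheory.

(** * Schemes *)

Record openSet (X : topologicalType) := OpenSet {
  open_set :> set X;
  open_setP : open open_set
}.

Definition open_mem (X : topologicalType) (U : openSet X) (x : X) : Prop :=
  open_set U x.
Coercion open_mem : openSet >-> Funclass.

Definition full_open (X : topologicalType) : openSet X :=
  OpenSet (@openT X).

(* The stalks are part of the data, together with the germ maps; the last
   three axioms say that they are the direct limits of the rings of sections. *)
Record locallyRingedSpace := LocallyRingedSpace {
  space :> topologicalType;
  sect : openSet space -> comPzRingType;
  res : forall U W : openSet space, W `<=` U -> {rmorphism sect U -> sect W};
  res_id : forall (U : openSet space) (h : U `<=` U) s, res h s = s;
  res_comp : forall (U W Z : openSet space) (h : W `<=` U) (h' : Z `<=` W)
    (h'' : Z `<=` U) s, res h' (res h s) = res h'' s;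
  sect_separated : forall (U : openSet space) (s t : sect U),
    (forall x, U x -> exists (W : openSet space) (h : W `<=` U),
       W x /\ res h s = res h t) -> s = t;
  sect_glue : forall (U : openSet space) (J : Type) (W : J -> openSet space)
    (h : forall j, W j `<=` U) (s : forall j, sect (W j)),
    (forall x, U x -> exists j, W j x) ->
    (forall i j (Z : openSet space) (hi : Z `<=` W i) (hj : Z `<=` W j),
       res hi (s i) = res hj (s j)) ->
    exists t : sect U, forall j, res (h j) t = s j;
  stalk : space -> localRing;
  germ : forall (U : openSet space) (x : space), U x ->
    {rmorphism sect U -> stalk x};
  germ_res : forall (U W : openSet space) (h : W `<=` U) x (hU : U x)
    (hW : W x) s, germ hW (res h s) = germ hU s;
  germ_surj : forall x (a : stalk x), exists (U : openSet space) (hU : U x) s,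
    germ hU s = a;
  germ_eq0 : forall (U : openSet space) x (hU : U x) s, germ hU s = 0 ->
    exists (W : openSet space) (h : W `<=` U), W x /\ res h s = 0
}.

Section AffineOpens.
Variables (X : locallyRingedSpace) (U : openSet X).

(* The prime ideal of sect U attached to a point of U. *)
Definition point_ideal x (hx : U x) : set (sect U) :=
  [set s | maxid (germ hx s)].

Definition basic_open (s : sect U) : set X :=
  [set x | exists hx : U x, ~ point_ideal hx s].

(* The canonical morphism from U to Spec (sect U) is an isomorphism: it is
   bijective, the D(s) generate the topology of U, and the sections on D(s)
   are the localization of sect U at s. *)
Definition is_affine :=
  [/\ (forall P : set (sect U), is_prime_ideal P ->
         exists x (hx : U x), point_ideal hx = P),
      (forall x y (hx : U x) (hy : U y),
         point_ideal hx = point_ideal hy -> x = y),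
      (forall (W : openSet X) x, W `<=` U -> W x ->
         exists s, basic_open s x /\ basic_open s `<=` W) &
      (forall s (W : openSet X) (h : W `<=` U), basic_open s = W ->
         [/\ invertible (res h s),
             (forall t, exists n a, res h s ^+ n * t = res h a) &
             (forall a, res h a = 0 -> exists n, s ^+ n * a = 0)])].

End AffineOpens.

Record scheme := Scheme {
  scheme_space :> locallyRingedSpace;
  schemeP : forall x : scheme_space,
    exists U : openSet scheme_space, U x /\ is_affine U
}.

(* A ring morphism from k is a k-algebra structure; the algebra B is
   k[X_1..X_n]/(f_1..f_c) with an invertible c x c minor of the Jacobian. *)
Definition standard_smooth (k : fieldType) (B : comPzRingType)
    (alg : {rmorphism k -> B}) :=
  exists (n c : nat) (f : 'I_c -> {mpoly k[n]})
    (pr : {rmorphism {mpoly k[n]} -> B}) (col : 'I_c -> 'I_n),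
    [/\ (forall a, pr a%:MP = alg a),
        (forall b, exists p, pr p = b),
        (forall p, pr p = 0 <-> exists g : 'I_c -> {mpoly k[n]},
           p = \sum_(i < c) g i * f i) &
        invertible (pr (\det (\matrix_(i < c, j < c) (f i)^`M(col j))))].

(* A k-scheme structure on V is a k-algebra structure on its global sections. *)
Definition is_smooth (k : fieldType) (V : scheme)
    (str : {rmorphism k -> sect (full_open V)}) :=
  forall x : V, exists U : openSet V,
    [/\ U x, is_affine U &
        exists2 alg : {rmorphism k -> sect U},
          (forall a, alg a = res (U := full_open V) (@subsetT _ U) (str a)) & standard_smooth alg].

(** * Rees algebras *)

Definition is_subalgebra (A : comNzRingType) (B : set {poly A}) :=
  [/\ (forall a, B a%:P), (forall p q, B p -> B q -> B (p + q)) &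
      (forall p q, B p -> B q -> B (p * q))].

Definition alg_span (A : comNzRingType) (S : set {poly A}) : set {poly A} :=
  [set p | forall B, is_subalgebra B -> S `<=` B -> B p].

Section ReesAlgebras.
Variable V : scheme.

Definition ideal_sheaf_data := forall U : openSet V, set (sect U).

Definition is_ideal_sheaf (J : ideal_sheaf_data) :=
  [/\ (forall U, is_ideal (J U)),
      (forall (U W : openSet V) (h : W `<=` U) s, J U s -> J W (res h s)) &
      (forall (U : openSet V) (s : sect U),
         (forall x, U x -> exists (W : openSet V) (h : W `<=` U),
            W x /\ J W (res h s)) -> J U s)].

Definition stalk_ideal (J : ideal_sheaf_data) (x : V) : set (stalk x) :=
  [set a | exists (U : openSet V) (hx : U x) s, J U s /\ germ hx s = a].

Arguments stalk_ideal J x _ : clear implicits.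

Implicit Type G : nat -> ideal_sheaf_data.

(* The stalk at x of the graded algebra, in the polynomials in W over the
   local ring at x. *)
Definition rees_stalk G (x : V) : set {poly stalk x} :=
  [set p | forall n, stalk_ideal (G n) x p`_n].

Arguments rees_stalk G x _ : clear implicits.

Definition is_rees_algebra G :=
  [/\ (forall n, is_ideal_sheaf (G n)),
      (forall U, G 0%N U = setT),
      (forall m n U s t, G m U s -> G n U t -> G (m + n)%N U (s * t)) &
      (forall x : V, exists (U : openSet V) (r : nat) (f : 'I_r -> sect U)
         (d : 'I_r -> nat), U x /\ forall y (hy : U y),
           rees_stalk G y =
           alg_span [set (germ hy (f i))%:P * 'X^(d i) | i in setT])].

(* An ideal of a local ring has order >= n when it is contained in M^n. *)
Definition Sing G : set V :=
  [set x | forall n, (1 <= n)%N ->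
     stalk_ideal (G n) x `<=` ideal_pow (@maxid (stalk x)) n].

(* The subalgebra generated by I_N W^N.  Sections of the algebra sheaf generated
   by a family are those whose germs belong to the generated algebras. *)
Definition rees_pow G (N : nat) : nat -> ideal_sheaf_data :=
  fun n U => [set s | forall x (hx : U x),
    alg_span [set a%:P * 'X^N | a in stalk_ideal (G N) x]
      ((germ hx s)%:P * 'X^n)].

(* The images of the stalks of the G n in M^n/M^(n+1) are meaningful at the
   points of Sing G. *)
Definition initial_ideal G (x : V) : set (gr (stalk x)) :=
  ideal_span [set xi | exists n a,
    [/\ (1 <= n)%N, stalk_ideal (G n) x a & xi = gr_class n a]].

Arguments initial_ideal G x _ : clear implicits.

(* The zero set of the initial ideal in T, as a set of primes of gr. *)
Definition cone G (x : V) : set (set (gr (stalk x))) :=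
  [set P | is_prime_ideal P /\ initial_ideal G x `<=` P].

Arguments cone G x _ : clear implicits.

Definition tau G (x : V) : nat := codim (vertices (cone G x)).

End ReesAlgebras.

Arguments stalk_ideal {V} J x _.
Arguments rees_stalk {V} G x _.
Arguments initial_ideal {V} G x _.
Arguments cone {V} G x _.

(* Main.v *)
(* The two cones coincide as sets of primes.  Locally G_N is contained in G,
   so its initial ideal is contained in that of G.  Conversely, the initial
   forms of positive degree of G lie in any prime containing those of the
   generators f_i W^(n_i); and the (N/n_i)-th power of the initial form of f_i
   is the initial form of f_i^(N/n_i), an element of I_N. *)
Require Import Defs.
From HB Require Import structures.
From mathcomp Require Import all_boot all_order all_algebra.
From mathcomp Require Import ring_quotient generic_quotient.
From mathcomp Require Import boolp classical_sets topology_structure.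

Local Open Scope classical_set_scope.
Local Open Scope ring_scope.

Import GRing.Theory.

Section Ideals.
Variable A : comPzRingType.
Implicit Types I : set A.

Lemma prime_ideal_exp I a n : is_prime_ideal I -> I (a ^+ n) -> I a.
Proof.
case=> _ I1 IM; elim: n => [|n IHn]; first by rewrite expr0.
by rewrite exprS => /IM[].
Qed.

End Ideals.

Section AlgSpan.
Variable A : comNzRingType.
Implicit Types (B S : set {poly A}).

Lemma alg_span_subalgebra S : is_subalgebra (alg_span S).
Proof.
split=> [a B [BC _ _] _|p q Sp Sq B HB SB|p q Sp Sq B HB SB] //.
  by case: (HB) => _ BD _; apply: BD; [apply: Sp|apply: Sq].
by case: (HB) => _ _; apply; [apply: Sp|apply: Sq].
Qed.

Lemma subalgebra_exp B p n : is_subalgebra B -> B p -> B (p ^+ n).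
Proof.
move=> [BC _ BM] Bp; elim: n => [|n IHn]; first by rewrite expr0 -polyC1.
by rewrite exprS; apply: BM.
Qed.

End AlgSpan.

Section AssociatedGraded.
Local Open Scope quotient_scope.
Variable R : localRing.
Implicit Types (a b : R) (P : set (gr R)).

Lemma gr_class_val m a : ideal_pow (@maxid R) m a ->
  val (insubd (0 : mrees R) (a%:P * 'X^m)) = a%:P * 'X^m.
Proof.
move=> Ma; rewrite val_insubd ifT //; apply/asboolP=> i.
rewrite coefCM coefXn; case: eqP => [->|_]; first by rewrite mulr1.
by rewrite mulr0; case: (ideal_pow_ideal (@maxid R) i).
Qed.

Lemma gr_classD m a b :
  ideal_pow (@maxid R) m a -> ideal_pow (@maxid R) m b ->
  gr_class m (a + b) = gr_class m a + gr_class m b.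
Proof.
move=> Ma Mb; have [_ MD _] := ideal_pow_ideal (@maxid R) m.
rewrite /gr_class -(rmorphD (\pi_(gr R))); congr (\pi_(gr R) _).
apply: val_inj; rewrite [RHS]raddfD /= !gr_class_val //; last exact: MD.
by rewrite polyCD mulrDl.
Qed.

Lemma gr_class0r m : gr_class m (0 : R) = 0.
Proof.
have [M0 _ _] := ideal_pow_ideal (@maxid R) m.
by apply: (addrI (gr_class m 0)); rewrite -gr_classD // !addr0.
Qed.

Lemma gr_classM m l a b :
  ideal_pow (@maxid R) m a -> ideal_pow (@maxid R) l b ->
  gr_class (m + l) (a * b) = gr_class m a * gr_class l b.
Proof.
move=> Ma Mb; rewrite /gr_class -(rmorphM (\pi_(gr R))); congr (\pi_(gr R) _).
apply: val_inj; rewrite [RHS]rmorphM /= !gr_class_val //; last exact: ideal_powD.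
by rewrite polyCM exprD mulrACA.
Qed.

Lemma ideal_pow_exp (I : set R) m a l :
  ideal_pow I m a -> ideal_pow I (l * m) (a ^+ l).
Proof.
move=> Ia; elim: l => [|l IHl] //.
by rewrite exprS mulSn; apply: ideal_powD.
Qed.

Lemma gr_classX m a l : ideal_pow (@maxid R) m a ->
  gr_class (l * m) (a ^+ l) = gr_class m a ^+ l.
Proof.
move=> Ma; elim: l => [|l IHl].
  by rewrite !expr0 mul0n; apply: (rmorph1 (gr_class 0)).
by rewrite !exprS mulSn gr_classM ?IHl //; apply: ideal_pow_exp.
Qed.

Definition initial_forms_in P : set {poly R} :=
  [set p | forall m, ideal_pow (@maxid R) m p`_m /\
                     ((0 < m)%N -> P (gr_class m p`_m))].

Lemma initial_forms_in_subalgebra P :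
  is_ideal P -> is_subalgebra (initial_forms_in P).
Proof.
move=> HP; have [P0 PD PM] := HP.
split=> [a|p q Hp Hq|p q Hp Hq] m; have [M0 MD MM] := ideal_pow_ideal (@maxid R) m.
- by rewrite coefC; case: m M0 {MD MM} => [|m] M0 //=; rewrite gr_class0r.
- rewrite coefD; have [Mp Pp] := Hp m; have [Mq Pq] := Hq m.
  split=> [|m0]; first exact: MD.
  by rewrite gr_classD //; apply: PD; auto.
rewrite coefM; pose Q l a := ideal_pow (@maxid R) l a /\
  ((0 < l)%N -> P (gr_class l a)).
apply: (big_ind (Q m)) => [|a b [Ma Pa] [Mb Pb]|i _].
- by split=> // _; rewrite gr_class0r.
- by split=> [|m0]; [apply: MD|rewrite gr_classD //; apply: PD; auto].
have le_im : (i <= m)%N by rewrite -ltnS.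
have [Mp Pp] := Hp i; have [Mq Pq] := Hq (m - i)%N.
suff : Q (i + (m - i))%N (p`_i * q`_(m - i)) by rewrite subnKC.
rewrite /Q gr_classM //; split; first exact: ideal_powD.
rewrite addn_gt0 => /orP[i0|mi0]; last by apply: PM; apply: Pq.
by rewrite mulrC; apply: PM; apply: Pp.
Qed.

Lemma initial_forms_in_monomial P m a : is_ideal P ->
  ideal_pow (@maxid R) m a -> P (gr_class m a) ->
  initial_forms_in P (a%:P * 'X^m).
Proof.
move=> [P0 _ _] Ma Pa i; rewrite coefCM coefXn.
case: eqP => [->|_]; first by rewrite mulr1.
by rewrite mulr0 gr_class0r; case: (ideal_pow_ideal (@maxid R) i).
Qed.

End AssociatedGraded.

Section ReesAlgebras.
Variables (V : scheme) (G : nat -> ideal_sheaf_data V) (x : V).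

Lemma rees_stalk_monomial m a : (forall l, is_ideal_sheaf (G l)) ->
  rees_stalk G x (a%:P * 'X^m) <-> stalk_ideal (G m) x a.
Proof.
move=> HG; split=> [/(_ m)|Ga l]; first by rewrite coefCM coefXn eqxx mulr1.
rewrite coefCM coefXn; case: eqP => [->|_]; first by rewrite mulr1.
rewrite mulr0; exists (full_open V), I, 0; rewrite rmorph0; split=> //.
by have [/(_ (full_open V)) []] := HG l.
Qed.

Lemma stalk_rees_pow_sub N m : (forall l, is_ideal_sheaf (G l)) ->
  is_subalgebra (rees_stalk G x) ->
  stalk_ideal (rees_pow G N m) x `<=` stalk_ideal (G m) x.
Proof.
move=> HG Galg _ [U [hU [t [Gt <-]]]].
apply/rees_stalk_monomial => //; apply: (Gt) => // _ [a Ga <-].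
exact/rees_stalk_monomial.
Qed.

Lemma stalk_sub_rees_pow N :
  stalk_ideal (G N) x `<=` stalk_ideal (rees_pow G N N) x.
Proof.
move=> _ [U [hU [t [Gt <-]]]]; exists U, hU, t; split=> // y hy B _; apply.
by exists (germ hy t) => //; exists U, hy, t.
Qed.

Lemma cone_rees_pow (s : nat) (f : 'I_s -> stalk x) (n : 'I_s -> nat) (N : nat) :
  (forall l, is_ideal_sheaf (G l)) -> Sing G x -> (forall i, (1 <= n i)%N) ->
  rees_stalk G x = alg_span [set (f i)%:P * 'X^(n i) | i in setT] ->
  (0 < N)%N -> (forall i, (n i %| N)%N) ->
  cone (rees_pow G N) x = cone G x.
Proof.
move=> HG hx hn hgen hN hdvd.
have Galg : is_subalgebra (rees_stalk G x).
  by rewrite hgen; apply: alg_span_subalgebra.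
have Gf i : rees_stalk G x ((f i)%:P * 'X^(n i)).
  by rewrite hgen => B _; apply; exists i.
apply/seteqP; split=> P [Pp IP]; split=> // xi; have [Pid _ _] := Pp; last first.
  move=> Ixi; apply: IP; apply: Ixi; first exact: ideal_span_ideal.
  move=> _ [m [a [m0 Ga ->]]]; apply: sub_ideal_span; exists m, a; split=> //.
  exact: stalk_rees_pow_sub Ga.
apply=> // _ [m [a [m0 Ga ->]]].
have Pf i : initial_forms_in (stalk x) P ((f i)%:P * 'X^(n i)).
  have Mf : ideal_pow (@maxid (stalk x)) (n i) (f i).
    by apply: hx => //; apply/rees_stalk_monomial.
  apply: initial_forms_in_monomial => //.
  apply: (@prime_ideal_exp _ _ _ (N %/ n i)) => //.
  rewrite -gr_classX // divnK //; apply: IP; apply: sub_ideal_span.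
  exists N, (f i ^+ (N %/ n i)); split=> //; apply: stalk_sub_rees_pow.
  apply/rees_stalk_monomial => //.
  rewrite -{2}(divnK (hdvd i)) mulnC exprM polyC_exp -exprMn.
  apply: (subalgebra_exp _ (rees_stalk G x)) => //; exact: Gf.
have /(_ m)[_ /(_ m0)] : initial_forms_in (stalk x) P (a%:P * 'X^m).
  have : rees_stalk G x (a%:P * 'X^m) by apply/rees_stalk_monomial.
  rewrite hgen; apply=> [|_ [i _ <-]] //; exact: initial_forms_in_subalgebra.
by rewrite coefCM coefXn eqxx mulr1.
Qed.

End ReesAlgebras.

Theorem lemma5p5 (k : fieldType) (V : scheme)
    (str : {rmorphism k -> sect (full_open V)}) (hV : is_smooth str)
    (G : nat -> ideal_sheaf_data V) (hG : is_rees_algebra G)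
    (x : V) (hx : Sing G x)
    (s : nat) (f : 'I_s -> stalk x) (n : 'I_s -> nat)
    (hn : forall i, (1 <= n i)%N)
    (hgen : rees_stalk G x = alg_span [set (f i)%:P * 'X^(n i) | i in setT])
    (N : nat) (hN : (0 < N)%N) (hdvd : forall i, (n i %| N)%N) :
  tau G x = tau (rees_pow G N) x.
Proof. by case: hG => HG _ _ _; rewrite /tau (cone_rees_pow _ _ _ _ f n). Qed.
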